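(* There is a function $N:\mathbb{N}\to\mathbb{N}$ such that the following holds. Let $K$ be an infinite field, let $G$ be any group, let $n\ge 1$, and let $\mathbf{g}=(g_1,\dots,g_n)\in G^n$ be an $n$-tuple of pairwise different elements. Consider $M_n(K)$ with the elementary $G$-grading induced by $\mathbf{g}$. Then a basis of the $G$-graded polynomial identities of $M_n(K)$ consists of the polynomials (1) $x_1x_2-x_2x_1$, where $x_1,x_2\in X_\epsilon$; (2) $x_1x_3x_2-x_2x_3x_1$, where $x_1,x_2\in X_h$, $x_3\in X_{h^{-1}}$, $h\in G$, $h\neq\epsilon$; (3) $x_1$, where $x_1\in X_h$ and $h\in G$ is such that $(M_n(K))_h=0$; together with a finite number of graded identities of $M_n(K)$ that are monomials $x_{i_1}\cdots x_{i_k}$ in the variables of $X$, of length $k$ with $2\le k\le N(n)$. That is, there is a finite set $\mathcal{M}$ of such monomial identities for which $T_G(M_n(K))$ equals the $T_G$-ideal generated by the polynomials (1), (2), (3) and $\mathcal{M}$.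
   Context: $\epsilon$ is the identity element of $G$. The elementary grading of $M_n(K)$ induced by $\mathbf{g}=(g_1,\dots,g_n)\in G^n$ is the $G$-grading $M_n(K)=\bigoplus_{g\in G}(M_n(K))_g$ in which each matrix unit $E_{ij}$ is homogeneous of degree $g_i^{-1}g_j$. Let $\{X_g\mid g\in G\}$ be a family of disjoint countably infinite sets, $X=\bigcup_{g\in G}X_g$, and $K\langle X\rangle$ the free associative algebra freely generated by $X$. It is $G$-graded by giving the variables in $X_g$ degree $g$, so that a monomial $x_{i_1}\cdots x_{i_k}$ with $x_{i_l}\in X_{h_l}$ has degree $h_1\cdots h_k$. A polynomial $f(x_1,\dots,x_k)\in K\langle X\rangle$ is a graded polynomial identity of a $G$-graded algebra $A$ if $f(a_1,\dots,a_k)=0$ whenever each $a_l$ belongs to $A_{h}$, where $h$ is the degree of $x_l$. $T_G(A)$ denotes the set of all graded identities of $A$. A $T_G$-ideal is an ideal of $K\langle X\rangle$ invariant under all graded endomorphisms of $K\langle X\rangle$; the $T_G$-ideal generated by $S\subset K\langle X\rangle$ is the intersection of all $T_G$-ideals containing $S$. $S$ is a basis of the graded identities of $A$ if $T_G(A)$ is the $T_G$-ideal generated by $S$. *)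

(* Defs.v *)
From HB Require Import structures.
From mathcomp Require Import all_boot all_order all_algebra finmap.
From mathcomp.classical Require Import boolp classical_sets cardinality.
From mathcomp.multinomials Require Import monalg.

Set Implicit Arguments.
Unset Strict Implicit.
Unset Printing Implicit Defensive.

Import GRing.Theory.
Local Open Scope classical_set_scope.
Local Open Scope ring_scope.

(* The variables X = \bigcup_h X_h : the pairs (h, i) with i : nat enumerate
   the countably infinite set X_h. *)
Definition gvar (G : groupType) : Type := (G * nat)%type.

Definition var_deg (G : groupType) (x : gvar G) : G := x.1.

Definition gmonom (G : groupType) := {fmonom gvar G}.

Definition monom_deg (G : groupType) (m : gmonom G) : G :=
  (\prod_(x <- m) var_deg x)%g.

(* K<X>, with unit; its elements have coefficients indexed by words in X. *)
Notation free_galg K G := {malg K[{fmonom gvar G}]}.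

Definition gX (K : fieldType) (G : groupType) (x : gvar G) : free_galg K G :=
  << fmu x >>.

Definition free_component (K : fieldType) (G : groupType) (h : G) :
    set (free_galg K G) :=
  [set f | forall m : gmonom G, m \in msupp f -> monom_deg m = h].

Definition graded_endo (K : fieldType) (G : groupType)
    (phi : {lrmorphism free_galg K G -> free_galg K G}) : Prop :=
  forall h f, free_component h f -> free_component h (phi f).

Record two_sided_ideal (R : pzRingType) (I : set R) : Prop := {
  ideal0 : I 0;
  idealB : forall f g, I f -> I g -> I (f - g);
  idealMl : forall p f, I f -> I (p * f);
  idealMr : forall p f, I f -> I (f * p)
}.

Definition TG_ideal (K : fieldType) (G : groupType) (I : set (free_galg K G)) :
    Prop :=
  two_sided_ideal I /\
  forall phi : {lrmorphism free_galg K G -> free_galg K G},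
    graded_endo phi -> forall f, I f -> I (phi f).

Definition TG_ideal_gen (K : fieldType) (G : groupType)
    (S : set (free_galg K G)) : set (free_galg K G) :=
  smallest (@TG_ideal K G) S.

Definition geval (K : fieldType) (G : groupType) (A : algType K)
    (a : gvar G -> A) (f : free_galg K G) : A :=
  mmap (in_alg A) (fun m : gmonom G => \prod_(x <- m) a x) f.

(* A G-grading of A is given by its family of homogeneous components. *)
Definition graded_identities (K : fieldType) (G : groupType) (A : algType K)
    (comp : G -> set A) : set (free_galg K G) :=
  [set f | forall a : gvar G -> A,
     (forall x, comp (var_deg x) (a x)) -> geval a f = 0].

Definition graded_basis (K : fieldType) (G : groupType) (A : algType K)
    (comp : G -> set A) (S : set (free_galg K G)) : Prop :=
  graded_identities comp = TG_ideal_gen S.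

Definition elementary_component (K : fieldType) (G : groupType) (n : nat)
    (g : 'I_n.+1 -> G) (h : G) : set 'M[K]_n.+1 :=
  [set A | A \in (\sum_(p : 'I_n.+1 * 'I_n.+1 | ((g p.1)^-1 * g p.2)%g == h)
                    <[delta_mx p.1 p.2]>)%VS].

Definition neutral_commutators (K : fieldType) (G : groupType) :
    set (free_galg K G) :=
  [set f | exists x1 x2 : gvar G,
     [/\ var_deg x1 = 1%g, var_deg x2 = 1%g
       & f = gX K x1 * gX K x2 - gX K x2 * gX K x1]].

Definition exchange_polynomials (K : fieldType) (G : groupType) :
    set (free_galg K G) :=
  [set f | exists (h : G) (x1 x2 x3 : gvar G),
     [/\ h <> 1%g, var_deg x1 = h, var_deg x2 = h, var_deg x3 = (h^-1)%g
       & f = gX K x1 * gX K x3 * gX K x2 - gX K x2 * gX K x3 * gX K x1]].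

Definition zero_component_variables (K : fieldType) (G : groupType)
    (A : algType K) (comp : G -> set A) : set (free_galg K G) :=
  [set f | exists x : gvar G, comp (var_deg x) = [set 0] /\ f = gX K x].

Arguments neutral_commutators K G : clear implicits.
Arguments exchange_polynomials K G : clear implicits.
Arguments elementary_component K {G n} g h.

(* Main.v *)
(* A word [s] labels, for each vertex [g i], a walk [g i, g i * deg, ...] in the
   group; evaluated on generic homogeneous matrices, its row [i] is zero if this
   walk leaves [{g_1, ..., g_n}], and otherwise has one nonzero entry, the product
   of indeterminates indexed by the edges of the walk.

   Two words whose walks from [g i] stay in this set and have the same edges
   (with multiplicity) are Eulerian trails of the same directed multigraph, and
   the exchanges (1), (2) transform one into the other.  Over an infinite field
   the coefficients of an identity therefore sum to zero on each class of such
   words, so that only words with no walk from any [g i] (zero words) remain.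

   A word is zero as soon as, for each of the [n] starting vertices, one of its
   prefixes leads outside.  Keeping these at most [n] prefixes and merging the
   letters in between exhibits the word as a consequence of a zero word of length
   at most [n], so one can take [N(n) = n]. *)
Require Import Defs.
From HB Require Import structures.
From mathcomp Require Import all_boot all_order all_algebra finmap.
From mathcomp.classical Require Import boolp classical_sets cardinality.
From mathcomp.multinomials Require Import monalg.

Set Implicit Arguments.
Unset Strict Implicit.
Unset Printing Implicit Defensive.

Import GRing.Theory.
Local Open Scope classical_set_scope.
Local Open Scope ring_scope.

(** * Scalars in a monoid algebra *)

Section MonoidAlgebra.

Variables (M : monomType) (R : comNzRingType).

Lemma malgUZ (c : R) (m : M) : << c *g m >> = c *: << m >> :> {malg R[M]}.
Proof.
by apply/malgP => k; rewrite mcoeffZ !mcoeffU; case: eqP; rewrite ?mulr1 ?mulr0.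
Qed.

(** Central coefficients are what lets a multiplicative map on monomials extend to a ring morphism
    into a noncommutative algebra. *)
Lemma malgC_central (c : R) (f : {malg R[M]}) : f * c%:MP = c%:MP * f.
Proof.
rewrite mul_malgC (monalgE f) mulr_suml scaler_sumr; apply: eq_bigr => m _.
by rewrite malgM_def fgmulUU mulm1 (malgUZ (_ * _)) (malgUZ f@_m) scalerA mulrC.
Qed.

End MonoidAlgebra.

(** * Words in the free algebra, and graded substitutions of words for variables *)

HB.lock Definition word (K : fieldType) (G : groupType) (s : seq (gvar G)) :
  free_galg K G := << FMonom s >>.

Section Words.

Variables (K : fieldType) (G : groupType).
Implicit Types (s t u v w : seq (gvar G)) (f : free_galg K G).

Local Notation word := (@word K G).

Definition wdeg s : G := (\prod_(x <- s) var_deg x)%g.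

Lemma wdeg_cat s t : wdeg (s ++ t) = (wdeg s * wdeg t)%g.
Proof. exact: big_cat. Qed.

Lemma wdeg_cons x s : wdeg (x :: s) = (x.1 * wdeg s)%g.
Proof. exact: big_cons. Qed.

Lemma wdeg_nil : wdeg [::] = 1%g.
Proof. exact: big_nil. Qed.

Lemma word_nil : word [::] = 1.
Proof. by rewrite word.unlock -fmoneE. Qed.

Lemma word_cat s t : word (s ++ t) = word s * word t.
Proof.
rewrite word.unlock malgM_def fgmulUU mulr1; congr << _ >>.
exact: esym (fmmulE (FMonom s) (FMonom t)).
Qed.

Lemma gXE x : gX K x = word [:: x].
Proof. by rewrite /gX fmuE word.unlock. Qed.

Lemma word_cons x s : word (x :: s) = gX K x * word s.
Proof. by rewrite gXE -word_cat. Qed.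

Lemma word2E x y : word [:: x; y] = gX K x * gX K y.
Proof. by rewrite !gXE; exact: (word_cat [:: x] [:: y]). Qed.

Lemma word3E x y z : word [:: x; y; z] = gX K x * gX K y * gX K z.
Proof. by rewrite -word2E gXE; exact: (word_cat [:: x; y] [:: z]). Qed.

Lemma mcoeff_word s (m : gmonom G) : (word s)@_m = (s == m)%:R.
Proof. by rewrite word.unlock mcoeffU -val_eqE. Qed.

Lemma wordE s : word s = \prod_(x <- s) gX K x.
Proof.
by elim: s => [|x s IH]; rewrite ?big_nil ?word_nil// big_cons word_cons IH.
Qed.

Lemma free_galgE f : f = \sum_(m <- msupp f) f@_m *: word m.
Proof.
by rewrite {1}[f]monalgE; apply: eq_bigr => m _; rewrite malgUZ word.unlock fmK.
Qed.

Lemma word_homogeneous s : free_component (wdeg s) (word s).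
Proof. by move=> m; rewrite word.unlock msuppU1 inE => /eqP ->. Qed.

Definition subst_monom (sigma : gvar G -> seq (gvar G)) (m : gmonom G) :=
  word (flatten (map sigma m)).

Lemma subst_monom_mmorphism sigma : mmorphism (subst_monom sigma).
Proof.
split=> [m1 m2|]; last by rewrite /subst_monom fm1 word_nil.
by rewrite /subst_monom fmM map_cat flatten_cat word_cat.
Qed.

HB.instance Definition _ sigma :=
  isMultiplicative.Build (gmonom G) (free_galg K G) (subst_monom sigma)
    (subst_monom_mmorphism sigma).

Definition subst sigma : free_galg K G -> free_galg K G :=
  mmap (@malgC (gmonom G) K) (subst_monom sigma).

Lemma subst_is_additive sigma : zmod_morphism (subst sigma).
Proof. by move=> f h; rewrite /subst raddfB. Qed.

Lemma subst_is_multiplicative sigma : monoid_morphism (subst sigma).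
Proof.
have [] := @commr_mmap_is_multiplicative (gmonom G) K (free_galg K G)
  malgC (subst_monom sigma); last by [].
by move=> f m m'; rewrite /GRing.comm malgC_central.
Qed.

Lemma subst_is_scalable sigma : scalable (subst sigma).
Proof. by move=> c f; rewrite /subst mmapZ mul_malgC. Qed.

HB.instance Definition _ sigma :=
  GRing.isZmodMorphism.Build (free_galg K G) (free_galg K G) (subst sigma)
    (subst_is_additive sigma).
HB.instance Definition _ sigma :=
  GRing.isMonoidMorphism.Build (free_galg K G) (free_galg K G) (subst sigma)
    (subst_is_multiplicative sigma).
HB.instance Definition _ sigma :=
  GRing.isScalable.Build K (free_galg K G) (free_galg K G) *:%R (subst sigma)
    (subst_is_scalable sigma).

Lemma substB sigma f h : subst sigma (f - h) = subst sigma f - subst sigma h.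
Proof. exact: raddfB. Qed.

Lemma subst_word sigma s : subst sigma (word s) = word (flatten (map sigma s)).
Proof. by rewrite /subst word.unlock mmapU mul1r /subst_monom word.unlock. Qed.

(** Replacing each letter by a word of its degree preserves the degree of a word, and every word in
    the image comes from one of [f]. *)
Lemma graded_subst sigma :
  (forall x, wdeg (sigma x) = x.1) -> graded_endo (subst sigma).
Proof.
move=> sigmaP h f fh m; rewrite (free_galgE f) raddf_sum /=.
have wdeg_subst s : wdeg (flatten (map sigma s)) = wdeg s.
  elim: s => [|x s IH] //=.
  by rewrite wdeg_cat IH sigmaP wdeg_cons.
rewrite big_seq -mcoeff_neq0 raddf_sum /= => sum_neq0.
apply/eqP/negP => /negP mh; case/negP: sum_neq0; apply/eqP.
rewrite big1 // => k kf; rewrite linearZ /= mcoeffZ subst_word mcoeff_word.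
case: eqP => [E|_]; last by rewrite mulr0.
case/negP: mh; apply/eqP; rewrite -(fh k kf) /monom_deg -E.
exact: wdeg_subst.
Qed.

End Words.

(** * Walks of words in the group *)

Section Trails.

Variable G : groupType.
Implicit Types (c d : G) (x y : gvar G) (s t u v w : seq (gvar G)).

(* The walk of the word [s] from the vertex [c] in the graph on [G] where the
   letter [x] labels the edges [c -> c * x.1]; the pair [(c, x)] stands for
   that edge. *)
Fixpoint edges c s : seq (G * gvar G) :=
  if s is x :: s' then (c, x) :: edges (c * x.1)%g s' else [::].

Definition target (e : G * gvar G) : G := (e.1 * e.2.1)%g.

Definition visits c s : seq G := c :: map target (edges c s).

Lemma edges_cat c s t : edges c (s ++ t) = edges c s ++ edges (c * wdeg s)%g t.
Proof.
elim: s c => [|x s IH] c /=; first by rewrite wdeg_nil mulg1.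
by rewrite IH wdeg_cons mulgA.
Qed.

Lemma size_edges c s : size (edges c s) = size s.
Proof. by elim: s c => //= x s IH c; rewrite IH. Qed.

Lemma visits_cons c x s : visits c (x :: s) = c :: visits (c * x.1)%g s.
Proof. by []. Qed.

Lemma visits_cat c s t :
  visits c (s ++ t) = visits c s ++ behead (visits (c * wdeg s)%g t).
Proof. by rewrite /visits edges_cat map_cat. Qed.

Lemma edges_split c s e : e \in edges c s ->
  exists s1 s2, s = s1 ++ e.2 :: s2 /\ e.1 = (c * wdeg s1)%g.
Proof.
elim: s c => [|x s IH] c //=; rewrite inE => /orP[/eqP ->|/IH].
  by exists [::], s; rewrite wdeg_nil mulg1.
move=> [s1 [s2 [-> ->]]]; exists (x :: s1), s2.
by rewrite wdeg_cons mulgA.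
Qed.

Lemma visits_split c s d : d \in visits c s ->
  exists s1 s2, s = s1 ++ s2 /\ d = (c * wdeg s1)%g.
Proof.
rewrite inE => /orP[/eqP ->|/mapP[e /edges_split[s1 [s2 [-> E]]] ->]].
  by exists [::], s; rewrite wdeg_nil mulg1.
exists (rcons s1 e.2), s2; rewrite cat_rcons; split=> //.
by rewrite -cats1 wdeg_cat wdeg_cons wdeg_nil mulg1 mulgA -E.
Qed.

Lemma walk_invariant (P : G -> Prop) d t : P d ->
  (forall e, e \in edges d t -> P e.1 -> P (target e)) ->
  forall e, e \in edges d t -> P e.1.
Proof.
elim: t d => [|x t IH] d //= Pd Pstep e.
rewrite inE => /orP[/eqP -> //|]; apply: IH.
  by apply: (Pstep (d, x)); rewrite ?mem_head.
by move=> e' e't; apply: Pstep; rewrite inE e't orbT.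
Qed.

End Trails.

(** * Congruence of words modulo a T_G-ideal containing (1) and (2) *)

Section ExchangeCongruence.

Variables (K : fieldType) (G : groupType) (I : set (free_galg K G)).
Implicit Types (f h p : free_galg K G).
Implicit Types (c d : G) (x y : gvar G) (s t u v w : seq (gvar G)).

Hypothesis I_TG : TG_ideal I.
Hypothesis I_comm : neutral_commutators K G `<=` I.
Hypothesis I_exch : exchange_polynomials K G `<=` I.

Lemma TG_idealD f h : I f -> I h -> I (f + h).
Proof.
have [[I0 IB _ _] _] := I_TG => If Ih.
by rewrite -[h]opprK; apply: (IB) => //; rewrite -sub0r; apply: IB.
Qed.

Lemma TG_idealZ (a : K) f : I f -> I (a *: f).
Proof.
by have [[_ _ IM _] _] := I_TG => If; rewrite -mul_malgC; apply: IM.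
Qed.

Lemma TG_ideal_sum (J : Type) (r : seq J) (P : pred J) F :
  (forall i, P i -> I (F i)) -> I (\sum_(i <- r | P i) F i).
Proof.
move=> IF; elim/big_rec: _ => [|i f Pi If]; first by case: I_TG => -[].
by apply: TG_idealD => //; apply: IF.
Qed.

Lemma TG_ideal_subst sigma f :
  (forall x, wdeg (sigma x) = x.1) -> I f -> I (subst sigma f).
Proof. by move=> sigmaP; apply: I_TG.2; apply: graded_subst. Qed.

Definition congr_word s t := I (word K s - word K t).

Lemma congr_word_trans t s u :
  congr_word s t -> congr_word t u -> congr_word s u.
Proof. by move=> /TG_idealD/[apply]; rewrite addrA subrK. Qed.

Lemma congr_word_cat u v s t :
  congr_word s t -> congr_word (u ++ s ++ v) (u ++ t ++ v).
Proof.
have [[_ _ IMl IMr] _] := I_TG => st.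
by rewrite /congr_word !word_cat -mulrBr -mulrBl; apply/IMl/IMr.
Qed.

Lemma congr_word_subst sigma s t : (forall x, wdeg (sigma x) = x.1) ->
  congr_word s t ->
  congr_word (flatten (map sigma s)) (flatten (map sigma t)).
Proof.
move=> sigmaP /(TG_ideal_subst sigmaP).
by rewrite (substB sigma (word K s) (word K t)) !subst_word.
Qed.

Lemma congr_word_comm u v :
  wdeg u = 1%g -> wdeg v = 1%g -> congr_word (u ++ v) (v ++ u).
Proof.
move=> u1 v1; pose x i : gvar G := (1%g, i).
pose sigma y := if y == x 0%N then u else if y == x 1%N then v else [:: y].
have sigma0 : sigma (x 0%N) = u by rewrite /sigma eqxx.
have sigma1 : sigma (x 1%N) = v by rewrite /sigma eqxx; case: eqP => // -[].
have sigmaP y : wdeg (sigma y) = y.1.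
  rewrite /sigma; case: eqP => [->//|_]; case: eqP => [->//|_].
  by rewrite wdeg_cons wdeg_nil mulg1.
have xx : congr_word [:: x 0%N; x 1%N] [:: x 1%N; x 0%N].
  apply: I_comm; exists (x 0%N), (x 1%N); split=> //.
  by rewrite !word2E.
by have := congr_word_subst sigmaP xx; rewrite /= !cats0 sigma0 sigma1.
Qed.

(** In degree other than 1 this is an instance of (2). In degree 1, which (2) excludes, commute [u]
    with [v ++ w], then [v] with [w]. *)
Lemma congr_word_exchange u v w :
  wdeg u = wdeg w -> wdeg v = ((wdeg u)^-1)%g ->
  congr_word (u ++ v ++ w) (w ++ v ++ u).
Proof.
move=> uw vu; have [u1|/eqP u1] := eqVneq (wdeg u) 1%g.
  have v1 : wdeg v = 1%g by rewrite vu u1 invg1.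
  have w1 : wdeg w = 1%g by rewrite -uw.
  have vw1 : wdeg (v ++ w) = 1%g by rewrite wdeg_cat v1 w1 mulg1.
  have := congr_word_cat [::] u (congr_word_comm v1 w1).
  by rewrite /= -(catA w); apply: congr_word_trans (congr_word_comm u1 vw1).
(* The index 2 keeps [z] apart from [x 0] and [x 1] even when [h] is its own inverse. *)
pose h := wdeg u; pose x i : gvar G := (h, i); pose z : gvar G := (h^-1, 2)%g.
pose sigma y :=
  if y == x 0%N then u else if y == x 1%N then w else
  if y == z then v else [:: y].
have sigma0 : sigma (x 0%N) = u by rewrite /sigma eqxx.
have sigma1 : sigma (x 1%N) = w by rewrite /sigma eqxx; case: eqP => // -[].
have sigma2 : sigma z = v.
  by rewrite /sigma eqxx; case: eqP => [[]//|_]; case: eqP => [[]|].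
have sigmaP y : wdeg (sigma y) = y.1.
  rewrite /sigma; case: eqP => [->//|_]; case: eqP => [->//|_].
  by case: eqP => [->//|_]; rewrite wdeg_cons wdeg_nil mulg1.
have xx : congr_word [:: x 0%N; z; x 1%N] [:: x 1%N; z; x 0%N].
  apply: I_exch; exists h, (x 0%N), (x 1%N), z; split=> //.
  by rewrite !word3E.
by have := congr_word_subst sigmaP xx; rewrite /= !cats0 sigma0 sigma1 sigma2.
Qed.

(* Both words are Eulerian trails of one directed multigraph.  If the second
   one starts with [y], cut the first one as [u ++ y :: v].  Unless the closed
   trail [u] is empty, [v] returns to a vertex of [u] (otherwise the second
   word could never traverse [u] after [y]), and an exchange at this vertex
   moves [y] to the front. *)
Lemma congr_word_trail c s t :
  perm_eq (edges c s) (edges c t) -> congr_word s t.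
Proof.
have [n] := ubnP (size s); elim: n => // n IHn in c s t *.
case: t => [|y t] /= sn st.
  case: s st {sn} => [|x s] /= /perm_size //= _.
  by rewrite /congr_word subrr; case: I_TG => -[].
(* It suffices to reach a word [y :: r] with the edges of [s]: the common first edge then cancels,
   and induction applies from the next vertex. *)
have IH r : perm_eq (edges c s) (edges c (y :: r)) ->
    congr_word (y :: r) (y :: t).
  move=> sr; rewrite -[y :: r]cat1s -[y :: t]cat1s -[r]cats0 -[t]cats0.
  apply: congr_word_cat; apply: (IHn (c * y.1)%g).
    by move/perm_size: sr; rewrite /= !size_edges => E; rewrite -ltnS -E.
  by rewrite -(perm_cons (c, y)) -(permPl sr).
have [] := @edges_split _ c s (c, y); first by rewrite (perm_mem st) mem_head.
move=> u [v [sE /= cu]]; set d := (c * y.1)%g.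
case: u => [|x u'] in sE cu *; first by rewrite sE; apply: IH; rewrite sE.
set u := x :: u' in sE cu *.
have edgesE : edges c s = edges c u ++ (c, y) :: edges d v.
  by rewrite sE edges_cat -cu.
have u1 : wdeg u = 1%g by apply: (mulgI c); rewrite -cu mulg1.
have [|disj] := pselect (exists2 e, e \in edges c u & e.1 \in visits d v).
  move=> [e /edges_split[u1' [u2 [uE eE]]] /visits_split[v1 [v2 [vE eE']]]].
  (* [w1] leads from [c] to the common vertex, [w2] back to [c], and [w3] to the common vertex
     again. Swapping [w1] and [w3] puts [y] first, and each block keeps its starting vertex, hence
     its edges. *)
  pose w1 := u1'; pose w2 := e.2 :: u2; pose w3 := y :: v1.
  have w31 : wdeg w1 = wdeg w3.
    by apply: (mulgI c); rewrite /w3 wdeg_cons mulgA -/d -eE'.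
  have w12 : (wdeg w1 * wdeg w2)%g = 1%g by rewrite -wdeg_cat -uE.
  have sE' : s = w1 ++ w2 ++ w3 ++ v2 by rewrite sE uE vE -!catA.
  have w2V : wdeg w2 = ((wdeg w1)^-1)%g.
    by apply: (mulgI (wdeg w1)); rewrite w12 mulgV.
  have := congr_word_cat [::] v2 (congr_word_exchange w31 w2V).
  rewrite cat0s cat0s -!catA -sE' => /congr_word_trans; apply.
  apply: (IH (v1 ++ w2 ++ w1 ++ v2)).
  rewrite -[y :: _]/(w3 ++ w2 ++ w1 ++ v2) sE' !edges_cat.
  have c1 : (c * wdeg w1 * wdeg w2)%g = c by rewrite -mulgA w12 mulg1.
  rewrite -w31 c1.
  apply/permP => p; rewrite !count_cat [RHS]addnCA.
  by rewrite (addnCA (count p (edges c w3))) addnCA.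
(* Without [(c, y)], the walk of [t] starts at [d], which is not a source of an edge of [u], and no
   edge of [v] ends at such a source. So [t] never uses the edge [(c, x)] of [u], a
   contradiction. *)
have st' : perm_eq (edges d t) (edges c u ++ edges d v).
  rewrite -(perm_cons (c, y)) -(permPl st) edgesE -cat1s perm_catCA.
  exact: perm_refl.
have disj' a : a \in visits d v -> a \notin map fst (edges c u).
  by move=> av; apply/mapP => -[e eu ae]; apply: disj; exists e; rewrite -?ae.
have xt : (c, x) \in edges d t by rewrite (perm_mem st') mem_cat mem_head.
have /(_ _ _ _ xt) := @walk_invariant _
  (fun a => a \notin map fst (edges c u)) d t.
rewrite /= mem_head => /(_ _ _)/negP; case=> //.
  by apply: disj'; rewrite mem_head.
move=> e; rewrite (perm_mem st') mem_cat => /orP[eu|ev _].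
  by rewrite (map_f fst eu).
by apply: disj'; rewrite inE (map_f (@target G) ev) orbT.
Qed.

End ExchangeCongruence.

(** * Zero words and their shortening *)

Section ZeroWords.

Variables (G : groupType) (n : nat) (g : 'I_n.+1 -> G).
Implicit Types (c d : G) (x y z : gvar G) (s t u v w : seq (gvar G)).

Definition vertex c := [exists i, g i == c].

Definition walkable c s := all vertex (visits c s).

Definition zero_word s := [forall i, ~~ walkable (g i) s].

(** The support of the grading, listed through the matrix units. *)
Definition degrees : seq G :=
  [seq ((g p.1)^-1 * g p.2)%g | p <- enum {: 'I_n.+1 * 'I_n.+1}].

Lemma degreesP h :
  reflect (exists i j, (g i * h)%g = g j) (h \in degrees).
Proof.
apply: (iffP mapP) => [[[i j] _ ->]|[i [j E]]].
  by exists i, j; rewrite mulVKg.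
by exists (i, j); rewrite ?mem_enum //= -E mulKg.
Qed.

Lemma visits_map_fst c s t : map fst s = map fst t -> visits c s = visits c t.
Proof.
elim: s t c => [|x s IH] [|y t] c //= [xy /IH st].
by rewrite !visits_cons xy st.
Qed.

Lemma zero_word_map_fst s t :
  map fst s = map fst t -> zero_word s = zero_word t.
Proof.
move=> st; rewrite /zero_word; apply: eq_forallb => i.
by rewrite /walkable (visits_map_fst _ st).
Qed.

(** The first entry satisfying [p] stands at another position, so it survives the deletion of
    [a]. *)
Lemma has_remove_nth (T : Type) (p : pred T) (r1 r2 : seq T) a :
  find p (r1 ++ a :: r2) != size r1 ->
  has p (r1 ++ a :: r2) -> has p (r1 ++ r2).
Proof.
rewrite find_cat !has_cat; case: (has p r1) => //=.
by case: (p a) => //=; rewrite addn0 eqxx.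
Qed.

(* Each of the [n.+1] candidate starting vertices is refuted at one position
   of [s]; a long word has a position which refutes none of them, and forgetting
   the vertex visited at this position keeps the word zero. *)
Lemma zero_word_shorten s : zero_word s -> (n.+1 < size s)%N ->
  (exists s1 x, s = rcons s1 x /\ zero_word s1) \/
  (exists s1 x y s2, s = s1 ++ x :: y :: s2 /\
     forall z, z.1 = (x.1 * y.1)%g -> zero_word (s1 ++ z :: s2)).
Proof.
move=> /forallP s0 ltns.
pose a i := find (predC vertex) (visits (g i) s).
(* Pigeonhole on the positions 1 to [size s]. Position 0 is left out: the start of a walk cannot be
   forgotten by merging letters. *)
have [b /[!mem_iota]/[!add1n]/[!ltnS]/andP[b_gt0 les] b_a] :
    exists2 b, b \in iota 1 (size s) & b \notin codom a.
  apply/hasP; apply: contraTT ltns; rewrite has_predC negbK -leqNgt => /allP.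
  move=> /(uniq_leq_size (iota_uniq _ _)).
  by rewrite size_iota size_codom card_ord.
have hasP' i : has (predC vertex) (visits (g i) s) by rewrite has_predC s0.
have a_b i : find (predC vertex) (visits (g i) s) != b.
  by apply: contra b_a => /eqP <-; apply: codom_f.
have size_visits c t : size (visits c t) = (size t).+1.
  by rewrite /= size_map size_edges.
(* The vertex at position [b] is where the letter [x] of index [b - 1] ends. If [x] is last it is
   dropped, otherwise it is merged with its successor. *)
have [x [s1 [t [sE size_s1]]]] :
    exists x s1 t, s = s1 ++ x :: t /\ (size s1).+1 = b.
  case: b b_gt0 les {b_a a_b} => // b _; case: (s) => // x0 s' les.
  exists (nth x0 (x0 :: s') b), (take b (x0 :: s')), (drop b.+1 (x0 :: s')).
  by rewrite -drop_nth // cat_take_drop size_take les.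
case: t => [|y s2] in sE *; [left; exists s1, x | right; exists s1, x, y, s2].
  rewrite -cats1; split=> //; apply/forallP => i.
  have := hasP' i; have := a_b i.
  rewrite sE visits_cat /= -size_s1 -(size_visits (g i)) => H /(has_remove_nth H).
  by rewrite cats0 has_predC.
split=> // z zE; apply/forallP => i; have := hasP' i; have := a_b i.
rewrite sE visits_cat /= -size_s1 -(size_visits (g i)) => H /(has_remove_nth H).
by rewrite has_predC /walkable visits_cat /= /target /= zE mulgA.
Qed.

(** Distinct indices make this the most general word with degrees [ds]: any other is obtained from
    it by a graded renaming of variables. *)
Definition label_word (ds : seq G) : seq (gvar G) := zip ds (iota 0 (size ds)).

Lemma map_fst_label ds : map fst (label_word ds) = ds.
Proof. by apply: unzip1_zip; rewrite size_iota. Qed.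

(** Lengths run from 2 to [n.+1], the size of the matrices. Degrees are taken from the support,
    which keeps the list finite for infinite [G]. *)
Definition short_zero_words : seq (seq (gvar G)) :=
  [seq s <- flatten [seq [seq label_word
                              [seq ((g p.1)^-1 * g p.2)%g | p <- val t]
                         | t : k.-tuple ('I_n.+1 * 'I_n.+1)]
                    | k <- iota 2 n]
  | zero_word s].

Lemma short_zero_wordsP s : s \in short_zero_words ->
  zero_word s /\ (2 <= size s <= n.+1)%N.
Proof.
rewrite mem_filter => /andP[s0 /flattenP[r /mapP[k kn ->]]].
move=> /mapP[t _ sE]; split=> //; rewrite mem_iota in kn.
by rewrite -(size_map fst) sE map_fst_label size_map size_tuple.
Qed.

Lemma mem_short_zero_words ds : {subset ds <= degrees} ->
  (2 <= size ds <= n.+1)%N -> zero_word (label_word ds) ->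
  label_word ds \in short_zero_words.
Proof.
move=> ds_deg size_ds ds0; rewrite mem_filter ds0.
have [t tE] : exists t : seq ('I_n.+1 * 'I_n.+1),
    ds = [seq ((g p.1)^-1 * g p.2)%g | p <- t].
  elim: ds ds_deg {ds0 size_ds} => [|d ds IH] dsP; first by exists [::].
  have [|t ->] := IH; first by move=> e e_ds; apply: dsP; rewrite inE e_ds orbT.
  have /mapP[p _ ->] := dsP d (mem_head _ _).
  by exists (p :: t).
apply/flattenP; exists [seq label_word
    [seq ((g p.1)^-1 * g p.2)%g | p <- val t']
    | t' : (size t).-tuple ('I_n.+1 * 'I_n.+1)].
  apply/mapP; exists (size t) => //.
  by move: size_ds; rewrite tE size_map mem_iota add2n ltnS.
by rewrite tE; apply/mapP; exists (in_tuple t); rewrite ?mem_enum.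
Qed.

End ZeroWords.

(** * Zero words as consequences of the short ones *)

Section ZeroWordsIdeal.

Variables (K : fieldType) (G : groupType) (n : nat) (g : 'I_n.+1 -> G).
Variable I : set (free_galg K G).
Implicit Types (x y z : gvar G) (s t : seq (gvar G)).

Hypothesis I_TG : TG_ideal I.
Hypothesis I_var : forall x, x.1 \notin degrees g -> I (gX K x).
Hypothesis I_short : forall s, s \in short_zero_words g -> I (word K s).

Lemma ideal_word_subst sigma s : (forall x, wdeg (sigma x) = x.1) ->
  I (word K s) -> I (word K (flatten (map sigma s))).
Proof.
by move=> sigmaP Is; rewrite -subst_word; apply: TG_ideal_subst.
Qed.

Lemma ideal_word_cat s u v : I (word K s) -> I (word K (u ++ s ++ v)).
Proof.
by have [[_ _ IMl IMr] _] := I_TG => Is; rewrite !word_cat; apply/IMl/IMr.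
Qed.

Lemma ideal_merged_word s1 x y s2 :
  (forall z, z.1 = (x.1 * y.1)%g -> I (word K (s1 ++ z :: s2))) ->
  I (word K (s1 ++ x :: y :: s2)).
Proof.
move=> Iz; pose s := s1 ++ s2.
(* An index above all those in [s] makes [z] fresh, so that [sigma] fixes [s1] and [s2]. *)
pose z : gvar G := ((x.1 * y.1)%g, (\max_(v <- s) v.2).+1).
have zs : z \notin s.
  apply/negP => zs; have := @leq_bigmax_seq _ s xpredT snd _ zs isT.
  by rewrite ltnn.
pose sigma v := if v == z then [:: x; y] else [:: v].
have sigmaP v : wdeg (sigma v) = v.1.
  rewrite /sigma; case: eqP => [->|_]; rewrite !wdeg_cons wdeg_nil mulg1 //.
have sigma_id t : z \notin t -> flatten (map sigma t) = t.
  move=> zt; rewrite -[RHS]map_id -[RHS]flatten_map1; congr flatten.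
  apply/eq_in_map => v vt; rewrite /sigma; case: eqP => // vz.
  by rewrite -vz vt in zt.
have := ideal_word_subst sigmaP (Iz z erefl).
move: zs; rewrite mem_cat negb_or => /andP[z1 z2].
by rewrite map_cat flatten_cat /= !sigma_id // /sigma eqxx.
Qed.

Lemma ideal_relabel_word s :
  I (word K (label_word (map fst s))) -> I (word K s).
Proof.
(* The label of index [i] goes to the letter of [s] at position [i]. The degree test and the default
   [v] leave all other variables fixed, so [f] is graded. *)
pose f v := if (nth v s v.2).1 == v.1 then nth v s v.2 else v.
have fP v : wdeg [:: f v] = v.1.
  by rewrite wdeg_cons wdeg_nil mulg1 /f; case: eqP.
move=> /(ideal_word_subst fP); rewrite flatten_map1.
suff -> : map f (label_word (map fst s)) = s by [].
have sizeE : size (label_word (map fst s)) = size s.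
  by rewrite size_zip size_iota size_map minnn.
case: s => // -[d0 k0] s' in f fP sizeE *.
set s := _ :: s' in f fP sizeE *.
apply: (@eq_from_nth _ (d0, k0)); rewrite size_map sizeE // => i i_s.
rewrite (nth_map (d0, k0)) ?sizeE // nth_zip ?size_iota //.
rewrite size_map nth_iota // add0n (nth_map (d0, k0)) // /f /=.
by rewrite (set_nth_default (d0, k0)) // eqxx.
Qed.

(** Induction on the length: a letter outside the support already lies in [I], a long word is
    shortened, and a short one is listed up to renaming. *)
Lemma zero_word_ideal s : zero_word g s -> I (word K s).
Proof.
have [k] := ubnP (size s); elim: k => // k IHk in s *; rewrite ltnS => sk s0.
have [/allP s_deg|/allPn[x xs x_deg]] := boolP (all [in degrees g] (map fst s));
  last first.
  have /mapP[y ys xE] := xs; have [s1 s2] := splitPr ys.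
  by apply: (@ideal_word_cat [:: y]); rewrite -gXE; apply: I_var; rewrite -xE.
have [lt_n_s|le_s_n] := ltnP n.+1 (size s).
  have [] := zero_word_shorten s0 lt_n_s.
    move=> [s1 [x [sE s10]]]; rewrite sE -cats1.
    apply: (@ideal_word_cat s1 [::]); apply: IHk => //.
    by rewrite sE size_rcons in sk.
  move=> [s1 [x [y [s2 [sE sz]]]]]; rewrite sE; apply: ideal_merged_word => z zE.
  apply: IHk; last exact: sz.
  by move: sk; rewrite sE !size_cat /= !addnS.
(* Words of length 0 or 1 with letters in the support do have a walk, so they are not zero. *)
case: s => [|x [|y s]] in s_deg s0 le_s_n {sk} *.
- have /forallP/(_ ord0)/negP[] := s0.
  by rewrite /walkable /= andbT; apply/existsP; exists ord0.
- have /degreesP[i [j ij]] : x.1 \in degrees g by apply: s_deg; rewrite mem_head.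
  have /forallP/(_ i)/negP[] := s0.
  rewrite /walkable /= /target /= andbT ij.
  by apply/andP; split; apply/existsP; [exists i|exists j].
apply/ideal_relabel_word/I_short/mem_short_zero_words => //.
  by rewrite size_map.
by rewrite (zero_word_map_fst _ (map_fst_label _)).
Qed.

End ZeroWordsIdeal.

(** * Separating monomials over an infinite field by Kronecker substitution *)

Section Kronecker.

(** Reduction modulo [B] isolates the lowest digit, and division by [B] shifts the others. *)
Lemma digits_inj (B k : nat) (a b : nat -> nat) :
  (forall i, a i < B)%N -> (forall i, b i < B)%N ->
  (\sum_(i < k) a i * B ^ i = \sum_(i < k) b i * B ^ i)%N ->
  forall i, (i < k)%N -> a i = b i.
Proof.
elim: k a b => [|k IH] a b aB bB; first by [].
have B_gt0 : (0 < B)%N by apply: leq_ltn_trans (aB 0%N).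
have shift (f : nat -> nat) : (\sum_(i < k.+1) f i * B ^ i =
                (\sum_(i < k) f i.+1 * B ^ i) * B + f 0)%N.
  rewrite big_ord_recl /= expn0 muln1 addnC big_distrl /=; congr (_ + _)%N.
  by apply: eq_bigr => i _; rewrite expnSr mulnA.
rewrite !shift => ab.
have ab0 : a 0%N = b 0%N.
  by have := congr1 (modn^~ B) ab; rewrite !modnMDl !modn_small.
move: ab; rewrite ab0 => /addIn/eqP; rewrite eqn_pmul2r // => /eqP ab.
by case=> // i; apply: (IH (fun i => a i.+1) (fun i => b i.+1)).
Qed.

Lemma sum_expn_count (B k : nat) (s : seq nat) : all (ltn^~ k) s ->
  (\sum_(j <- s) B ^ j = \sum_(i < k) count_mem (i : nat) s * B ^ i)%N.
Proof.
elim: s => [|j s IH] /= => [_|/andP[jk sk]].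
  by rewrite big_nil big1.
rewrite big_cons IH //; under [RHS]eq_bigr do rewrite mulnDl.
rewrite big_split /=; congr (_ + _)%N.
rewrite (bigD1 (Ordinal jk)) //= eqxx mul1n big1 ?addn0 // => i.
by rewrite -val_eqE /= eq_sym => /negbTE ->.
Qed.

(** Multiplicities in a sequence shorter than [B] are base [B] digits, so the sum determines
    them. *)
Lemma sum_expn_perm_eq (B : nat) (s t : seq nat) :
  (size s < B)%N -> (size t < B)%N ->
  (\sum_(j <- s) B ^ j == \sum_(j <- t) B ^ j)%N = perm_eq s t.
Proof.
move=> sB tB; apply/eqP/idP => [|st]; last exact: perm_big.
pose k := (\max_(j <- s ++ t) j).+1.
have ltk r : {subset r <= s ++ t} -> all (ltn^~ k) r.
  by move=> rP; apply/allP => j /rP jst; rewrite /= ltnS leq_bigmax_seq.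
rewrite !(@sum_expn_count B k); first last.
- by apply: ltk => j; rewrite mem_cat => ->.
- by apply: ltk => j; rewrite mem_cat orbC => ->.
move=> /(@digits_inj _ _ (fun i => count_mem i s) (fun i => count_mem i t)) st.
apply/allP => j jst; rewrite /= st //.
- by move=> i; apply: leq_ltn_trans sB; apply: count_size.
- by move=> i; apply: leq_ltn_trans tB; apply: count_size.
- by have /allP/(_ j jst) := ltk _ (fun _ => id).
Qed.

Lemma poly_eq0_infinite (K : fieldType) (p : {poly K}) :
  infinite_set [set: K] -> (forall z, p.[z] = 0) -> p = 0.
Proof.
move=> /(infinite_set_fset (size p))[r _ le_r] p0; apply/eqP.
apply: contraTT le_r => /max_poly_roots max_r; rewrite -ltnNge; apply: max_r.
  by apply/allP => z _; rewrite /root p0.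
exact: fset_uniq.
Qed.

(* Substituting [z ^+ (B ^ i)] for the [i]-th indeterminate, with [B] larger
   than all degrees, sends different monomials to different powers of [z]. *)
Lemma coef_sum_eq0 (K : fieldType) (T J : eqType) (r : seq J) (c : J -> K)
    (E : J -> seq T) (E0 : seq T) :
  infinite_set [set: K] ->
  (forall t : T -> K, \sum_(m <- r) c m * \prod_(e <- E m) t e = 0) ->
  \sum_(m <- r | perm_eq (E m) E0) c m = 0.
Proof.
(* [L] numbers all indeterminates involved, and its length bounds those of [E0] and of each [E m],
   so [B] exceeds every multiplicity. *)
move=> Kinf sum0; pose L := flatten (map E r) ++ E0.
pose B := (size L).+1; pose wt (s : seq T) := (\sum_(e <- s) B ^ index e L)%N.
pose p : {poly K} := \sum_(m <- r) c m *: 'X^(wt (E m)).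
have /(congr1 (fun q : {poly K} => q`_(wt E0))) : p = 0.
  apply: poly_eq0_infinite => // z.
  rewrite -(sum0 (fun e => z ^+ (B ^ index e L))) /p horner_sum.
  apply: eq_bigr => m _; rewrite hornerZ hornerXn; congr (_ * _).
  by rewrite /wt; elim/big_rec2: _ => [|e x y _ <-]; rewrite ?expr0 // exprD.
rewrite coef0 /p coef_sum => p_eq0; rewrite -[RHS]p_eq0 [LHS]big_mkcond.
rewrite [LHS]big_seq [RHS]big_seq.
apply: eq_bigr => m mr; rewrite coefZ coefXn eq_sym.
have EL : {subset E m <= L}.
  move=> e em; rewrite mem_cat; apply/orP; left.
  by apply/flattenP; exists (E m); rewrite ?map_f.
have E0L : {subset E0 <= L} by move=> e e0; rewrite mem_cat e0 orbT.
have permE s t : {subset s <= L} -> {subset t <= L} ->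
    perm_eq (map (index^~ L) s) (map (index^~ L) t) = perm_eq s t.
  move=> sL tL; apply/idP/idP => [|/perm_map//].
  (* An empty [L] offers no default for [nth], but then [s] and [t] are empty too. *)
  case: {+}L sL tL => [|e0 L'] sL tL.
    case: s sL => [|e s /(_ e (mem_head _ _))//].
    by case: t tL => // e t /(_ e (mem_head _ _)).
  move=> /(perm_map (nth e0 (e0 :: L'))); rewrite -!map_comp !map_id_in // => e.
    by move=> /tL /(nth_index e0).
  by move=> /sL /(nth_index e0).
have sizeL s : (size s <= size L -> size (map (index^~ L) s) < B)%N.
  by rewrite size_map ltnS.
have -> : (wt (E m) == wt E0) = perm_eq (E m) E0.
  rewrite -permE // -(@sum_expn_perm_eq B) ?sizeL ?size_cat ?leq_addl //.
    by rewrite !big_map.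
  apply: leq_trans (leq_addr _ _).
  have [r1 r2] := splitPr mr; rewrite map_cat flatten_cat size_cat /= size_cat.
  by rewrite addnCA leq_addr.
by case: ifP => _; rewrite ?mulr1 ?mulr0.
Qed.

End Kronecker.

(** * Evaluation, and identities as a T_G-ideal *)

Section Evaluation.

Variables (K : fieldType) (G : groupType).
Implicit Types (f : free_galg K G) (s : seq (gvar G)).

Lemma mcoeff_sub_sum f (p : pred (gmonom G)) m :
  (\sum_(m' <- msupp f | p m') f@_m' *: word K m')@_m = if p m then f@_m else 0.
Proof.
transitivity (\sum_(m' <- msupp f | p m') f@_m' * (m' == m)%:R).
  rewrite raddf_sum; apply: eq_bigr => m' _ /=.
  by rewrite mcoeffZ mcoeff_word val_eqE.
rewrite big_mkcond /=; have [mf|mf] := boolP (m \in msupp f).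
  rewrite (bigD1_seq m) ?fset_uniq //= eqxx mulr1 big1 ?addr0 // => m' /negbTE.
  by move=> ->; rewrite mulr0 if_same.
rewrite (mcoeff_outdom mf) if_same big_seq big1 // => m' m'f.
by case: eqP => [E|]; rewrite ?mulr0 ?if_same // -E m'f in mf *.
Qed.

Section Algebra.

Variables (A : algType K) (a : gvar G -> A).

Definition eval_monom (m : gmonom G) : A := \prod_(x <- m) a x.

Lemma eval_monom_mmorphism : mmorphism eval_monom.
Proof.
by split=> [m1 m2|]; rewrite /eval_monom ?fmM ?big_cat // fm1 big_nil.
Qed.

HB.instance Definition _ :=
  isMultiplicative.Build (gmonom G) A eval_monom eval_monom_mmorphism.

Lemma gevalE f : geval a f = \sum_(m <- msupp f) f@_m *: \prod_(x <- m) a x.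
Proof. by rewrite /geval mmapE; apply: eq_bigr => m _; rewrite /= mulr_algl. Qed.

Lemma gevalB f h : geval a (f - h) = geval a f - geval a h.
Proof. by rewrite /geval raddfB. Qed.

Lemma geval0 : geval a (0 : free_galg K G) = 0.
Proof. by rewrite /geval raddf0. Qed.

Lemma geval_sum (J : Type) (r : seq J) (F : J -> free_galg K G) :
  geval a (\sum_(i <- r) F i) = \sum_(i <- r) geval a (F i).
Proof. by rewrite /geval raddf_sum. Qed.

Lemma gevalM f h : geval a (f * h) = geval a f * geval a h.
Proof.
have [] := @commr_mmap_is_multiplicative (gmonom G) K A (in_alg A) eval_monom.
  by move=> p m m'; rewrite /GRing.comm /= mulr_algl mulr_algr.
by move=> + _; apply.
Qed.

Lemma gevalZ c f : geval a (c *: f) = c *: geval a f.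
Proof.
by have := @mmapZ (gmonom G) K A (in_alg A) eval_monom c f; rewrite mulr_algl.
Qed.

Lemma geval_word s : geval a (word K s) = \prod_(x <- s) a x.
Proof. by rewrite /geval word.unlock mmapU /= mulr_algl scale1r. Qed.

Lemma geval_gX x : geval a (gX K x) = a x.
Proof. by rewrite gXE geval_word big_seq1. Qed.

Lemma geval_commutator x y :
  geval a (gX K x * gX K y - gX K y * gX K x) = a x * a y - a y * a x.
Proof. by rewrite -!word2E gevalB !geval_word !big_cons big_nil !mulr1. Qed.

Lemma geval_exchange x y z :
  geval a (gX K x * gX K z * gX K y - gX K y * gX K z * gX K x) =
  a x * (a z * a y) - a y * (a z * a x).
Proof.
transitivity (geval a (word K [:: x; z; y] - word K [:: y; z; x])).
  by rewrite !word3E.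
by rewrite gevalB !geval_word !big_cons big_nil !mulr1.
Qed.

End Algebra.

Lemma geval_endo (A : algType K) (a : gvar G -> A)
    (phi : {lrmorphism free_galg K G -> free_galg K G}) f :
  geval a (phi f) = geval (fun x => geval a (phi (gX K x))) f.
Proof.
rewrite [in LHS](free_galgE f) linear_sum geval_sum gevalE.
apply: eq_bigr => m _; rewrite linearZ gevalZ wordE rmorph_prod; congr (_ *: _).
elim: (val m) => [|x s IH]; last by rewrite !big_cons gevalM IH.
by rewrite !big_nil -word_nil geval_word big_nil.
Qed.

(** By the hypothesis, the values of the polynomials [phi (gX K x)] are again admissible arguments
    for [f]. *)
Lemma graded_identities_TG (A : algType K) (comp : G -> set A) :
  (forall a h f, (forall x, comp (var_deg x) (a x)) -> free_component h f ->
     comp h (geval a f)) ->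
  TG_ideal (graded_identities comp : set (free_galg K G)).
Proof.
move=> compP; split; first split.
- by move=> a _; rewrite geval0.
- by move=> f h f0 h0 a aP; rewrite gevalB f0 // h0 // subrr.
- by move=> p f f0 a aP; rewrite gevalM f0 // mulr0.
- by move=> p f f0 a aP; rewrite gevalM f0 // mul0r.
move=> phi phi_graded f f0 a aP; rewrite geval_endo; apply: f0 => x.
apply: compP => //; apply: phi_graded; rewrite gXE.
by have := @word_homogeneous K G [:: x]; rewrite wdeg_cons wdeg_nil mulg1.
Qed.

Lemma TG_ideal_gen_TG (S : set (free_galg K G)) : TG_ideal (TG_ideal_gen S).
Proof.
split; first split.
- by move=> J [[[J0 _ _ _] _] _].
- move=> f h If Ih J JP; case: (JP) => -[[_ JB _ _] _] _.
  by apply: JB; [exact: If|exact: Ih].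
- by move=> p f If J JP; case: (JP) => -[[_ _ JM _] _] _; apply: JM; exact: If.
- by move=> p f If J JP; case: (JP) => -[[_ _ _ JM] _] _; apply: JM; exact: If.
by move=> phi phiP f If J JP; case: (JP) => -[_ Jphi] _; apply: Jphi => //; exact: If.
Qed.

End Evaluation.

(** * The elementary grading and its zero words *)

Section ElementaryGrading.

Variables (K : fieldType) (G : groupType) (n : nat) (g : 'I_n.+1 -> G).
Implicit Types (a : gvar G -> 'M[K]_n.+1) (f : free_galg K G).
Implicit Types (s : seq (gvar G)).

Definition homogeneous a := forall x, elementary_component K g (var_deg x) (a x).

(** Writing the degree condition as a step from [g i] by [h] matches nonzero entries with edges of
    walks. *)
Lemma elementary_componentP h (A : 'M[K]_n.+1) :
  elementary_component K g h A <->
  forall i j, A i j != 0 -> (g i * h)%g = g j.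
Proof.
split=> [/memv_sumP[vs vsP ->] i j|AP].
  apply: contra_neq_eq => gij; rewrite summxE big1 // => p /eqP ph.
  have /vlineP[k ->] := vsP p (introT eqP ph); rewrite !mxE.
  case: eqP => [ip|]; last by rewrite mulr0.
  case: eqP => [jp|]; last by rewrite mulr0.
  by case/eqP: gij; rewrite -ph ip jp mulVKg.
rewrite /elementary_component /= (matrix_sum_delta A).
apply: rpred_sum => i _; apply: rpred_sum => j _.
have [->|/AP ij] := eqVneq (A i j) 0; first by rewrite scale0r rpred0.
apply: rpredZ; apply: subvP (memv_line _).
by apply: (sumv_sup (i, j)) => //=; rewrite -ij mulKg.
Qed.

Lemma component_eq0 h : h \notin degrees g ->
  elementary_component K g h = [set 0].
Proof.
move=> hg; apply/seteqP; split=> A /=; last first.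
  by move=> ->; apply/elementary_componentP => i j; rewrite mxE eqxx.
move=> /elementary_componentP AP; apply/matrixP => i j; rewrite mxE.
apply/eqP; apply: contraNT hg => /AP ij; apply/degreesP; by exists i, j.
Qed.

(** A nonzero entry of a product requires a chain of nonzero entries of the factors, whose indices
    trace the walk of [s]. *)
Lemma prod_entry_neq0 a s i j : homogeneous a ->
  (\prod_(x <- s) a x) i j != 0 -> walkable g (g i) s /\ (g i * wdeg s)%g = g j.
Proof.
move=> a_hom; have vg k : vertex g (g k) by apply/existsP; exists k.
elim: s i => [|x s IH] i.
  rewrite big_nil mxE wdeg_nil mulg1 /walkable /= vg.
  by case: (i =P j) => [->|]; rewrite ?eqxx.
rewrite big_cons mxE => sum_neq0.
have /existsP[k] : [exists k, a x i k * (\prod_(y <- s) a y) k j != 0].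
  apply: contraNT sum_neq0; rewrite negb_exists => /forallP E.
  by apply/eqP/big1 => k _; apply/eqP/negPn.
rewrite mulf_eq0 negb_or => /andP[axk /IH[walk_s sE]].
have /elementary_componentP/(_ _ _ axk) ik := a_hom x.
rewrite wdeg_cons mulgA ik; split=> //.
by rewrite /walkable visits_cons /= vg ik.
Qed.

Lemma geval_homogeneous a h f : homogeneous a -> free_component h f ->
  elementary_component K g h (geval a f).
Proof.
move=> a_hom fh; apply/elementary_componentP => i j.
apply: contra_neq_eq => ij; rewrite gevalE summxE big_seq big1 // => m mf.
rewrite mxE; have [->|/prod_entry_neq0[]//] := eqVneq ((\prod_(x <- m) a x) i j) 0.
  by rewrite mulr0.
by move=> _ E; case/eqP: ij; rewrite -E -(fh m mf).
Qed.

Lemma graded_identities_elementary_TG :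
  TG_ideal (graded_identities (elementary_component K g)).
Proof. by apply: graded_identities_TG => a h f; apply: geval_homogeneous. Qed.

Lemma zero_word_identity s : zero_word g s ->
  graded_identities (elementary_component K g) (word K s).
Proof.
move=> /forallP s0 a a_hom; rewrite geval_word; apply/matrixP => i j.
rewrite [RHS]mxE; apply/eqP; apply: contraT => /(prod_entry_neq0 a_hom)[walk_s _].
by have := s0 i; rewrite walk_s.
Qed.

Lemma zero_component_identities :
  zero_component_variables (elementary_component K g) `<=`
  graded_identities (elementary_component K g).
Proof.
move=> _ [x [x0 ->]] a /(_ x); rewrite x0 geval_gX => ax.
exact: ax.
Qed.

(** * Pairwise different vertices: identities (1), (2) and generic matrices *)

Hypothesis g_inj : injective g.

(** As [g] is injective, row [i] of [A] is zero outside column [k]. *)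
Lemma component_mul_entry h (A B : 'M[K]_n.+1) i k j :
  elementary_component K g h A -> (g i * h)%g = g k ->
  (A * B) i j = A i k * B k j.
Proof.
move=> /elementary_componentP AP ik; rewrite mxE (bigD1 k) //= big1 ?addr0 //.
move=> l lk; have [->|/AP il] := eqVneq (A i l) 0; first by rewrite mul0r.
by rewrite ik in il; rewrite (g_inj il) eqxx in lk.
Qed.

Lemma component_mul_entry0 h (A B : 'M[K]_n.+1) i j :
  elementary_component K g h A -> ~ (exists k, (g i * h)%g = g k) ->
  (A * B) i j = 0.
Proof.
move=> /elementary_componentP AP iN; rewrite mxE big1 // => l _.
have [->|/AP il] := eqVneq (A i l) 0; first by rewrite mul0r.
by case: iN; exists l.
Qed.

Lemma component_entry_neq h (A : 'M[K]_n.+1) i k j :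
  elementary_component K g h A -> (g i * h)%g = g k -> j != k -> A i j = 0.
Proof.
move=> /elementary_componentP AP ik jk; apply/eqP; apply: contraT => /AP ij.
by rewrite ik in ij; rewrite (g_inj ij) eqxx in jk.
Qed.

(** Matrices of neutral degree are diagonal. *)
Lemma neutral_commutator_identities :
  neutral_commutators K G `<=` graded_identities (elementary_component K g).
Proof.
move=> _ [x1 [x2 [h1 h2 ->]]] a a_hom.
have := a_hom x1; have := a_hom x2; rewrite h1 h2 => c2 c1.
rewrite geval_commutator; apply/eqP; rewrite subr_eq0; apply/eqP.
have ii i : (g i * 1)%g = g i by rewrite mulg1.
apply/matrixP => i j.
rewrite (component_mul_entry _ _ c1 (ii i)) (component_mul_entry _ _ c2 (ii i)).
have [->|ji] := eqVneq j i; first by rewrite mulrC.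
rewrite (component_entry_neq c1 (ii i) ji) (component_entry_neq c2 (ii i) ji).
by rewrite !mulr0.
Qed.

(** In row [i], only the column [k] with [g i * h = g k] can be nonzero, and there both products
    multiply the same scalars, from the entries [(i, k)], [(k, i)], [(i, k)]. *)
Lemma exchange_identities :
  exchange_polynomials K G `<=` graded_identities (elementary_component K g).
Proof.
move=> _ [h [x1 [x2 [x3 [_ h1 h2 h3 ->]]]]] a a_hom.
have := a_hom x1; have := a_hom x2; have := a_hom x3.
rewrite h1 h2 h3 => c3 c2 c1.
rewrite geval_exchange; apply/eqP; rewrite subr_eq0; apply/eqP.
apply/matrixP => i j.
have [[k ik]|iN] := pselect (exists k, (g i * h)%g = g k); last first.
  by rewrite (component_mul_entry0 _ _ c1 iN) (component_mul_entry0 _ _ c2 iN).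
have ki : (g k * h^-1)%g = g i by rewrite -ik mulgK.
rewrite (component_mul_entry _ _ c1 ik) (component_mul_entry _ _ c2 ik).
rewrite !(component_mul_entry _ _ c3 ki).
have [->|jk] := eqVneq j k.
  by rewrite [LHS]mulrC [X in X * _ = _]mulrC -mulrA.
by rewrite (component_entry_neq c1 ik jk) (component_entry_neq c2 ik jk) !mulr0.
Qed.

(** Instead of indeterminates, arbitrary scalars [t] are attached to the edges; infinitely many
    scalars will make up for this. *)
Definition generic_matrix (t : G * gvar G -> K) (x : gvar G) : 'M[K]_n.+1 :=
  \matrix_(i, j) if (g i * x.1)%g == g j then t (g i, x) else 0.

Lemma generic_matrix_homogeneous t : homogeneous (generic_matrix t).
Proof.
move=> x; apply/elementary_componentP => i j; rewrite mxE.
by case: ifP => [/eqP//|]; rewrite eqxx.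
Qed.

(** The row of the product has at most one nonzero entry, so summing over [j] loses nothing and
    avoids naming the end of the walk. *)
Lemma generic_row_sum t s i :
  \sum_j (\prod_(x <- s) generic_matrix t x) i j =
  if walkable g (g i) s then \prod_(e <- edges (g i) s) t e else 0.
Proof.
have vg k : vertex g (g k) by apply/existsP; exists k.
elim: s i => [|x s IH] i.
  rewrite /walkable /= vg !big_nil (bigD1 i) //= mxE eqxx big1 ?addr0 // => j ji.
  by rewrite mxE eq_sym (negbTE ji).
rewrite /walkable visits_cons /= vg /=.
have [/existsP[k /eqP ik]|iN] := boolP (vertex g (g i * x.1)%g).
  under eq_bigr do rewrite big_cons
    (component_mul_entry _ _ (generic_matrix_homogeneous t x) (esym ik)).
  rewrite -mulr_sumr IH mxE -ik eqxx /walkable /= vg /= big_cons.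
  by case: ifP => // _; rewrite mulr0.
rewrite big1 // => j _; rewrite big_cons.
apply: component_mul_entry0 (generic_matrix_homogeneous t x) _ => -[k ik].
by case/negP: iN; apply/existsP; exists k; apply/eqP.
Qed.

(** * From the vanishing of coefficient sums to membership in the ideal *)

Hypothesis K_infinite : infinite_set [set: K].

(** The sum of row [i] of [f] on generic matrices vanishes for all [t], and the left side is its
    coefficient at the monomial with edges [E0]. *)
Lemma trail_class_coef_sum f i E0 :
  graded_identities (elementary_component K g) f ->
  \sum_(m <- msupp f | walkable g (g i) m && perm_eq (edges (g i) m) E0) f@_m
  = 0.
Proof.
move=> f0; rewrite -big_filter_cond.
apply: (coef_sum_eq0 (E := fun m : gmonom G => edges (g i) m)) => // t.
have := f0 _ (generic_matrix_homogeneous t); rewrite gevalE.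
move=> /matrixP E; have : \sum_j (\sum_(m <- msupp f) f@_m *:
    \prod_(x <- m) generic_matrix t x) i j = 0.
  by rewrite big1 // => j _; rewrite E mxE.
under eq_bigr do rewrite summxE; rewrite exchange_big /= => sum0.
rewrite -[RHS]sum0 big_filter [LHS]big_mkcond; apply: eq_bigr => m _.
under [RHS]eq_bigr do rewrite mxE; rewrite -mulr_sumr generic_row_sum.
by case: ifP => //; rewrite mulr0.
Qed.

Variable I : set (free_galg K G).

Hypothesis I_TG : TG_ideal I.
Hypothesis I_comm : neutral_commutators K G `<=` I.
Hypothesis I_exch : exchange_polynomials K G `<=` I.
Hypothesis I_var : forall x, x.1 \notin degrees g -> I (gX K x).
Hypothesis I_short : forall s, s \in short_zero_words g -> I (word K s).
Hypothesis I_id : I `<=` graded_identities (elementary_component K g).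

Lemma graded_identity_ideal f :
  graded_identities (elementary_component K g) f -> I f.
Proof.
have [k] := ubnP #|` msupp f|; elim: k => // k IHk in f *; rewrite ltnS => fk f0.
have [|[m0 m0f]] := fset_0Vmem (msupp f).
  by move/eqP; rewrite msupp_eq0 => /eqP ->; case: I_TG => -[].
(* Subtracting a part of [f] that contains [m0] and lies in [I] leaves an identity with smaller
   support, to which induction applies. *)
suff [p pm0 Ip] : exists2 p : pred (gmonom G), p m0 &
    I (\sum_(m <- msupp f | p m) f@_m *: word K m).
  set h := (\sum_(m <- _ | _) _) in Ip.
  have coefE m : (f - h)@_m = if p m then 0 else f@_m.
    rewrite mcoeffB /h mcoeff_sub_sum.
    by case: (p m); rewrite ?subrr ?subr0.
  rewrite -[f](subrK h); apply: TG_idealD => //; apply: IHk.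
    apply: leq_trans fk; apply: fproper_ltn_card; rewrite fproperE.
    apply/andP; split; [apply/fsubsetP => m | apply/fsubsetPn; exists m0 => //].
      by rewrite -!mcoeff_neq0 coefE; case: (p m); rewrite ?eqxx.
    by rewrite -mcoeff_eq0 coefE pm0.
  have [[_ TB _ _] _] := graded_identities_elementary_TG.
  by apply: TB => //; apply: I_id.
have [m0_zero|/forallPn[i /negPn walk_m0]] := boolP (zero_word g m0).
  exists (fun m : gmonom G => zero_word g m) => //.
  apply: TG_ideal_sum => // m m_zero; apply: TG_idealZ => //.
  exact: zero_word_ideal m_zero.
(* A single vertex [g i] from which [m0] has a walk suffices, since equal edges from one start
   already make words congruent. *)
pose p (m : gmonom G) := walkable g (g i) m &&
  perm_eq (edges (g i) m) (edges (g i) m0).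
exists p; first by rewrite /p walk_m0 perm_refl.
have sum0 := trail_class_coef_sum i (edges (g i) m0) f0.
(* The subtracted term is zero, but it turns the sum into a combination of differences of congruent
   words. *)
have -> : \sum_(m <- msupp f | p m) f@_m *: word K m =
    \sum_(m <- msupp f | p m) f@_m *: word K m
    - (\sum_(m <- msupp f | p m) f@_m) *: word K m0.
  by rewrite sum0 scale0r subr0.
rewrite scaler_suml -sumrB.
apply: TG_ideal_sum => // m /andP[_ mm0]; rewrite -scalerBr.
apply: TG_idealZ => //; exact: congr_word_trail mm0.
Qed.

End ElementaryGrading.

Theorem theorem5p2 :
  exists N : nat -> nat,
  forall (K : fieldType) (G : groupType) (n : nat) (g : 'I_n.+1 -> G),
    infinite_set [set: K] ->
    injective g ->
    exists M : {fset gmonom G},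
      (forall m : gmonom G, m \in M ->
         (2 <= fdeg m <= N n.+1)%N /\
         graded_identities (elementary_component K g) << m >>) /\
      graded_basis (elementary_component K g)
        (neutral_commutators K G `|` exchange_polynomials K G
         `|` zero_component_variables (elementary_component K g)
         `|` [set (<< m >> : free_galg K G) | m in [set` M]]).
Proof.
(* The matrices have size [n.+1], so [id] gives exactly the length bound of [short_zero_words]. *)
exists id => K G n g K_inf g_inj.
pose M := [fset (FMonom s : gmonom G) | s in short_zero_words g]%fset.
have M_id (m : gmonom G) : m \in M ->
    (2 <= fdeg m <= n.+1)%N /\
    graded_identities (elementary_component K g) << m >>.
  move=> /imfsetP[s /= /short_zero_wordsP[s0 size_s] ->].
  by split=> //; have := zero_word_identity s0; rewrite word.unlock.
exists M; split=> //; rewrite /graded_basis; set S := _ `|` _ `|` _ `|` _.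
have S_gen : S `<=` TG_ideal_gen S by move=> f Sf J [_]; apply.
have gen_id : TG_ideal_gen S `<=` graded_identities (elementary_component K g).
  move=> f; apply; split; first exact: graded_identities_elementary_TG.
  move=> h [[[|]|]|[m /= mM <-]].
  - exact: neutral_commutator_identities.
  - exact: exchange_identities.
  - exact: zero_component_identities.
  - by have [] := M_id m mM.
apply/seteqP; split=> // f; apply: graded_identity_ideal => //.
- exact: TG_ideal_gen_TG.
- by move=> h hP; apply: S_gen; left; left; left.
- by move=> h hP; apply: S_gen; left; left; right.
- move=> x xN; apply: S_gen; left; right; exists x; split=> //.
  exact: component_eq0.
- move=> s sP; apply: S_gen; right; exists (FMonom s); last by rewrite word.unlock.
  by apply/imfsetP; exists s.
Qed.
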